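(* Let $A$ be a real $d\times d$ matrix. Then $A$ is of maximal trace over orthogonal matrices if and only if $A$ is symmetric and as such it is positive semidefinite. On the other hand, $A$ is of maximal trace over rotation matrices if and only if $A$ is symmetric and has at most one negative eigenvalue, which, if it exists, is no larger in absolute value than the other eigenvalues of $A$. Consequently, if $A$ is of maximal trace over rotation matrices (respectively, over orthogonal matrices), then the trace of $A$ is nonnegative.
   Context: All matrices are real. A rotation matrix is an orthogonal matrix of determinant one, and $\mathrm{tr}$ denotes the trace. A real $d\times d$ matrix $M$ is said to be of maximal trace over rotation (respectively, orthogonal) matrices if $\mathrm{tr}(M)\geq \mathrm{tr}(UM)$ for every $d\times d$ rotation (respectively, orthogonal) matrix $U$. A symmetric matrix is positive semidefinite if and only if each of its eigenvalues is nonnegative. Eigenvalues of a symmetric matrix are listed with multiplicity as $\alpha_1,\ldots,\alpha_d$; the condition on a negative eigenvalue $\alpha_k$ means that it is the only negative one in the list and $|\alpha_k|\leq\alpha_j$ for all $j\neq k$.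
   Formalization: The final claim that the trace is nonnegative for A of maximal trace over rotation matrices is stated only for d ≠ 1, since for d = 1 the matrix A = (−1) is of maximal trace over rotations but has trace −1. *)

(* Defs.v *)
From HB Require Import structures.
From mathcomp Require Import all_boot all_order all_algebra.
From mathcomp Require Import reals.

Set Implicit Arguments.
Unset Strict Implicit.
Unset Printing Implicit Defensive.

Import Order.TTheory GRing.Theory Num.Theory.
Local Open Scope ring_scope.

Definition orthogonal_mx (R : realType) (d : nat) (U : 'M[R]_d) : Prop :=
  U *m U^T = 1%:M.

Definition rotation_mx (R : realType) (d : nat) (U : 'M[R]_d) : Prop :=
  orthogonal_mx U /\ \det U = 1.

Definition max_trace_over (R : realType) (d : nat) (P : 'M[R]_d -> Prop)
    (M : 'M[R]_d) : Prop :=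
  forall U : 'M[R]_d, P U -> \tr (U *m M) <= \tr M.

Definition possemidef (R : realType) (d : nat) (A : 'M[R]_d) : Prop :=
  A \is symmetricmx /\ (forall a : R, eigenvalue A a -> 0 <= a).

(* Multiplicities are algebraic, i.e. those of the roots of the characteristic
   polynomial; for symmetric matrices they agree with the geometric ones. *)
Definition eigenvalue_listing (R : realType) (d : nat) (A : 'M[R]_d)
    (alpha : 'I_d -> R) : Prop :=
  char_poly A = \prod_(i < d) ('X - (alpha i)%:P).

(* A listing exists only when char_poly A splits over R, which always holds for
   symmetric A; it is then unique up to the order of the entries, to which the
   condition below is insensitive. *)
Definition at_most_one_small_neg (R : realType) (d : nat) (A : 'M[R]_d) : Prop :=
  exists alpha : 'I_d -> R, eigenvalue_listing A alpha /\
    forall k : 'I_d, alpha k < 0 ->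
      forall j : 'I_d, j != k -> 0 <= alpha j /\ `|alpha k| <= alpha j.

(* Main.v *)
Require Import Defs.
From HB Require Import structures.
From mathcomp Require Import all_boot all_order all_algebra all_fingroup.
From mathcomp Require Import reals ring lra.
From mathcomp Require Import complex.

Set Implicit Arguments.
Unset Strict Implicit.
Unset Printing Implicit Defensive.

Import Order.TTheory GRing.Theory Num.Theory.
Local Open Scope ring_scope.

(** The criterion is tested on reflections.  Let H_w be the reflection in the
    hyperplane orthogonal to w.

    Necessity.  For a matrix A of maximal trace over orthogonal matrices, and an
    eigenvector w of eigenvalue l, comparing tr (H_w A) = tr A - 2 l with tr A
    gives 0 <= l.  For maximal trace over rotations, use the rotations H_u H_v:
    they give a quadratic inequality in u and v ([max_rotation_quadratic]).  Its
    first-order part near u = v forces A to be symmetric ([max_rotation_sym]),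
    and for orthonormal u and v it says that u A u^T + v A v^T >= 0
    ([max_rotation_pair]).  On an orthonormal basis of eigenvectors this means
    that any two eigenvalues have a nonnegative sum, which is the condition on
    the negative eigenvalue ([at_most_one_small_neg_spectral]); on the standard
    basis it bounds the sum of two diagonal entries, whence the sign of the trace
    ([mxtrace_ge0_pairs]).

    Sufficiency.  Diagonalize A = Q^T D Q with Q orthogonal
    ([symmetric_spectral]).  If D >= 0 then tr (U A) <= tr A because diagonal
    entries of orthogonal matrices are at most 1
    ([nonneg_spectrum_mxtrace_le]).  If there is a negative eigenvalue - m with
    eigenvector q, then A - m H_q has nonnegative eigenvalues, so only H_q has to
    be compared with U H_q.  The latter is orthogonal of determinant -1, so it
    has the eigenvalue -1 and its trace is at most d - 2 = tr H_q
    ([improper_mxtrace_le], [pairwise_nonneg_mxtrace_le]).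

    In size 1 the only rotation is the identity, every matrix is of maximal trace
    over rotations, and there is no pair of eigenvalues to compare: hence the
    restriction on d in the last claim. *)

(** * Reflections and orthogonal matrices *)

Definition vdot (R : realType) (d : nat) (u v : 'rV[R]_d) : R :=
  (u *m v^T) 0 0.

(** The reflection in the hyperplane orthogonal to w; for w = 0 the quotient is 0
    and this is the identity, which keeps most lemmas free of a hypothesis on w. *)
Definition householder (R : realType) (d : nat) (w : 'rV[R]_d) : 'M[R]_d :=
  1%:M - (2 / vdot w w) *: (w^T *m w).

(** The rows of Q are an orthonormal family of eigenvectors, so that a 0 i belongs
    to row i Q. *)
Definition spectral_decomposition (R : realType) (d : nat) (A : 'M[R]_d)
    (Q : 'M[R]_d) (a : 'rV[R]_d) : Prop :=
  orthogonal_mx Q /\ A = Q^T *m diag_mx a *m Q.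

Lemma symmetricmxP (R : realType) (d : nat) (A : 'M[R]_d) :
  reflect (A^T = A) (A \is symmetricmx).
Proof.
apply: (iffP (is_hermitianmxP _ _ _)); rewrite expr0 scale1r map_mx_id //.
Qed.

Lemma orthogonal_trmxl (R : realType) (d : nat) (U : 'M[R]_d) :
  orthogonal_mx U -> U^T *m U = 1%:M.
Proof. exact: mulmx1C. Qed.

Lemma orthogonal_trmx (R : realType) (d : nat) (U : 'M[R]_d) :
  orthogonal_mx U -> orthogonal_mx U^T.
Proof. by move=> hU; rewrite /orthogonal_mx trmxK; exact: orthogonal_trmxl. Qed.

Lemma orthogonal_mulmx (R : realType) (d : nat) (U V : 'M[R]_d) :
  orthogonal_mx U -> orthogonal_mx V -> orthogonal_mx (U *m V).
Proof.
move=> hU hV; rewrite /orthogonal_mx trmx_mul mulmxA -(mulmxA U) hV mulmx1.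
exact: hU.
Qed.

Lemma vdotC (R : realType) (d : nat) (u v : 'rV[R]_d) : vdot u v = vdot v u.
Proof. by rewrite /vdot -[u *m _]trmxK trmx_mul trmxK mxE. Qed.

Lemma vdotE (R : realType) (d : nat) (u v : 'rV[R]_d) :
  u *m v^T = (vdot u v)%:M.
Proof. exact: mx11_scalar. Qed.

Lemma vdotDl (R : realType) (d : nat) (u v w : 'rV[R]_d) :
  vdot (u + v) w = vdot u w + vdot v w.
Proof. by rewrite /vdot mulmxDl mxE. Qed.

Lemma vdotZl (R : realType) (d : nat) (c : R) (u v : 'rV[R]_d) :
  vdot (c *: u) v = c * vdot u v.
Proof. by rewrite /vdot -scalemxAl mxE. Qed.

Lemma vdotDr (R : realType) (d : nat) (u v w : 'rV[R]_d) :
  vdot w (u + v) = vdot w u + vdot w v.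
Proof. by rewrite !(vdotC w) vdotDl. Qed.

Lemma vdotZr (R : realType) (d : nat) (c : R) (u v : 'rV[R]_d) :
  vdot v (c *: u) = c * vdot v u.
Proof. by rewrite !(vdotC v) vdotZl. Qed.

Lemma vdot_sumsq (R : realType) (d : nat) (u : 'rV[R]_d) :
  vdot u u = \sum_j u 0 j ^+ 2.
Proof. by rewrite /vdot mxE; apply: eq_bigr => j _; rewrite mxE expr2. Qed.

Lemma vdot_ge0 (R : realType) (d : nat) (u : 'rV[R]_d) : 0 <= vdot u u.
Proof. by rewrite vdot_sumsq sumr_ge0 // => j _; rewrite sqr_ge0. Qed.

Lemma vdot_eq0 (R : realType) (d : nat) (u : 'rV[R]_d) :
  (vdot u u == 0) = (u == 0).
Proof.
rewrite vdot_sumsq psumr_eq0; last by move=> j _; rewrite sqr_ge0.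
apply/allP/eqP => [h|-> j _]; last by rewrite /= mxE expr0n.
apply/rowP => j; rewrite mxE; apply/eqP.
by have /= := h j (mem_index_enum j); rewrite sqrf_eq0.
Qed.

Lemma vdot_gt0 (R : realType) (d : nat) (u : 'rV[R]_d) :
  (0 < vdot u u) = (u != 0).
Proof. by rewrite lt_def vdot_ge0 andbT vdot_eq0. Qed.

Lemma vdot_delta (R : realType) (d : nat) (u : 'rV[R]_d) (i : 'I_d) :
  vdot u (delta_mx 0 i) = u 0 i.
Proof. by rewrite /vdot trmx_delta -colE mxE. Qed.

Lemma vdot_row (R : realType) (d : nat) (U V : 'M[R]_d) (i j : 'I_d) :
  vdot (row i U) (row j V) = (U *m V^T) i j.
Proof. by rewrite /vdot !mxE; apply: eq_bigr => k _; rewrite !mxE. Qed.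

Lemma mxtrace_outer (R : realType) (d : nat) (u v : 'rV[R]_d) :
  \tr (u^T *m v) = vdot v u.
Proof. by rewrite mxtrace_mulC vdotE mxtrace_scalar mulr1n. Qed.

(** Sylvester's determinant identity: both sides are the determinant of the
    block matrix with rows [1, - B] and [A, 1], factored by eliminating either
    diagonal block. *)
Lemma det_1_add_mulC (R : realType) (m n : nat)
    (A : 'M[R]_(m, n)) (B : 'M[R]_(n, m)) :
  \det (1%:M + A *m B) = \det (1%:M + B *m A).
Proof.
have h : block_mx 1%:M 0 A 1%:M *m block_mx 1%:M (- B) 0 (1%:M + A *m B) =
         block_mx 1%:M (- B) 0 1%:M *m block_mx (1%:M + B *m A) 0 A 1%:M.
  rewrite !mulmx_block !(mul1mx, mulmx1, mul0mx, mulmx0, addr0, add0r).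
  rewrite mulmxN !mulNmx; congr block_mx; first by rewrite addrK.
  by rewrite addrC addrK.
move/(congr1 determinant): h.
by rewrite !det_mulmx !(det_lblock, det_ublock) !det1 !mul1r mulr1.
Qed.

Lemma trmx_householder (R : realType) (d : nat) (w : 'rV[R]_d) :
  (householder w)^T = householder w.
Proof. by rewrite /householder linearB /= trmx1 linearZ /= trmx_mul trmxK. Qed.

Lemma householder_orthogonal (R : realType) (d : nat) (w : 'rV[R]_d) :
  orthogonal_mx (householder w).
Proof.
rewrite /orthogonal_mx trmx_householder /householder.
set c := 2 / _; set P := w^T *m w.
have PP : P *m P = vdot w w *: P.
  by rewrite /P mulmxA -(mulmxA _ w) vdotE mul_mx_scalar -scalemxAl.
have cc : c * (c * vdot w w) = c + c.
  rewrite /c; have [->|n0] := eqVneq (vdot w w) 0.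
    by rewrite invr0 !mulr0 addr0.
  by field.
rewrite mulmxBl !mulmxBr !mul1mx mulmx1 -scalemxAl -scalemxAr PP !scalerA.
by rewrite -mulrA cc scalerDl opprB addrK subrK.
Qed.

Lemma det_householder (R : realType) (d : nat) (w : 'rV[R]_d) :
  w != 0 -> \det (householder w) = -1.
Proof.
rewrite -vdot_eq0 => n0.
rewrite /householder -scaleNr scalemxAl det_1_add_mulC -scalemxAr vdotE.
rewrite det_mx11 !mxE eqxx !mulr1n mulNr divfK //; lra.
Qed.

Lemma mxtrace_mul_householder (R : realType) (d : nat) (w : 'rV[R]_d)
    (A : 'M[R]_d) :
  \tr (householder w *m A) = \tr A - 2 / vdot w w * vdot (w *m A) w.
Proof.
rewrite /householder mulmxBl mul1mx linearB /= -scalemxAl linearZ /=.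
by rewrite -mulmxA mxtrace_outer.
Qed.

Lemma mul_householder (R : realType) (d : nat) (v w : 'rV[R]_d) :
  v *m householder w = v - (2 * vdot v w / vdot w w) *: w.
Proof.
rewrite /householder mulmxBr mulmx1 -scalemxAr mulmxA vdotE mul_scalar_mx.
by rewrite scalerA mulrAC.
Qed.

(** Two vectors of equal length are exchanged by the reflection in the
    hyperplane that bisects them.  The case u = v is included: the reflection
    along 0 is the identity. *)
Lemma householder_between (R : realType) (d : nat) (u v : 'rV[R]_d) :
  vdot u u = vdot v v -> u *m householder (v - u) = v.
Proof.
move=> huv; rewrite mul_householder; have [<-|n0] := eqVneq u v.
  by rewrite !subrr scaler0 subr0.
have n0' : vdot (v - u) (v - u) != 0 by rewrite vdot_eq0 subr_eq0 eq_sym.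
have e : 2 * vdot u (v - u) = - vdot (v - u) (v - u).
  rewrite -!scaleN1r !(vdotDl, vdotDr, vdotZl, vdotZr) (vdotC v u) huv; ring.
by rewrite e mulNr divff // scaleN1r opprK addrCA subrr addr0.
Qed.

(** * The spectral theorem for real symmetric matrices *)

(** Seen over the complex numbers the matrix is Hermitian, so the complex
    spectral theorem gives it a real eigenvalue; being an eigenvalue does not
    depend on the field, hence it also has a real eigenvector. *)
Lemma symmetric_eigenvalue (R : realType) (d : nat) (A : 'M[R]_d.+1) :
  A^T = A -> exists a, eigenvalue A a.
Proof.
move=> sA; set f := real_complex R; pose C := map_mx f A.
have fr x : f x \is Num.real by rewrite complex_real.
have Creal : C \is a mxOver Num.real.
  by apply/mxOverP => i j; rewrite mxE.
have Csym : C \is symmetricmx.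
  by apply/is_hermitianmxP; rewrite expr0 scale1r map_mx_id // map_trmx sA.
have Cherm := realsym_hermsym Csym Creal.
have /orthomx_spectralP := hermitian_normalmx Cherm.
have := hermitian_spectral_diag_real Cherm.
set P := spectralmx C; set a := spectral_diag C => /mxOverP ra eqC.
have Pu : P \in unitmx := spectral_unit C.
have : eigenvalue C (a 0 0).
  apply/eigenvalueP; exists (row 0 P).
    rewrite {1}eqC -row_mul !mulmxA mulmxV // mul1mx.
    by rewrite row_mul row_diag_mx -scalemxAl -rowE.
  apply/eqP => r0; have := congr1 (row 0) (mulmxV Pu).
  rewrite row_mul r0 mul0mx => /rowP/(_ 0); rewrite !mxE eqxx => /eqP.
  by rewrite eq_sym oner_eq0.
have /complex_realP [x ->] := ra 0 0.
by rewrite eigenvalue_map; exists x.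
Qed.

(** Induction on the size: a reflection H carries the first basis vector to a
    unit eigenvector, so H A H splits into a 1 x 1 block and a smaller symmetric
    block, to which the induction hypothesis applies. *)
Lemma symmetric_spectral (R : realType) (d : nat) (A : 'M[R]_d) :
  A^T = A -> exists Q a, spectral_decomposition A Q a.
Proof.
elim: d => [|d IHd] in A * => sA.
  by exists 1%:M, 0; split; apply/matrixP => -[].
have [l /eigenvalueP[v vA v0]] := symmetric_eigenvalue sA.
pose e : 'rV[R]_d.+1 := delta_mx 0 0.
(* The unit eigenvector, to be made the image of e under a reflection. *)
pose u := (Num.sqrt (vdot v v))^-1 *: v.
have uA : u *m A = l *: u by rewrite /u -scalemxAl vA !scalerA mulrC.
have uu : vdot e e = vdot u u.
  rewrite vdot_delta mxE eqxx /u vdotZl vdotZr mulrA -expr2 exprVn.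
  by rewrite sqr_sqrtr ?vdot_ge0 // mulVf // vdot_eq0.
pose H := householder (u - e).
have eH : e *m H = u := householder_between uu.
have HT : H^T = H := trmx_householder _.
have HH : H *m H = 1%:M by rewrite -{2}HT; exact: householder_orthogonal.
have uH : u *m H = e by rewrite -eH -mulmxA HH mulmx1.
pose B : 'M[R]_(1 + d) := H *m A *m H.
have sB : B^T = B by rewrite /B !trmx_mul HT sA mulmxA.
have eB : e *m B = l *: e by rewrite /B !mulmxA eH uA -scalemxAl uH.
have AB : A = H *m B *m H.
  by rewrite /B !mulmxA HH mul1mx -mulmxA HH mulmx1.
(* The first row of B is that of l%:M; by symmetry so is its first column. *)
clearbody B; have B0 j : B 0 j = l *+ (j == 0).
  have := congr1 (fun M : 'rV_(1 + d) => M 0 j) eB.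
  by rewrite -rowE !mxE eqxx /= => ->; rewrite mulr_natr.
have Bur : ursubmx B = 0.
  apply/matrixP => i j; rewrite !mxE.
  have -> : lshift d i = 0 by apply/val_inj; rewrite /= ord1.
  by rewrite B0.
have Bul : ulsubmx B = l%:M.
  apply/matrixP => i j; rewrite !mxE !ord1.
  have -> : lshift d (0 : 'I_1) = 0 by exact: val_inj.
  by rewrite B0 eqxx.
have Bdl : dlsubmx B = 0 by rewrite -sB -trmx_ursub Bur trmx0.
have [|Q [a [hQ hB]]] := IHd (drsubmx B); first by rewrite trmx_drsub sB.
pose Q1 : 'M[R]_(1 + d) := block_mx 1%:M 0 0 Q.
have hQ1 : orthogonal_mx Q1.
  rewrite /orthogonal_mx /Q1 tr_block_mx mulmx_block !trmx0 trmx1.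
  by rewrite !(mulmx0, mul0mx, mulmx1, addr0, add0r) hQ -scalar_mx_block.
exists (Q1 *m H), (row_mx l%:M a : 'rV_(1 + d)); split.
  exact: orthogonal_mulmx hQ1 (householder_orthogonal _).
rewrite AB.
suff -> : B = Q1^T *m diag_mx (row_mx l%:M a) *m Q1.
  by rewrite trmx_mul HT !mulmxA.
rewrite -[B]submxK Bul Bur Bdl hB diag_mx_row /Q1 tr_block_mx !mulmx_block.
rewrite !trmx0 trmx1 !(mulmx0, mul0mx, mulmx1, mul1mx, addr0, add0r).
congr block_mx; apply/matrixP => i j; rewrite !mxE !ord1 //.
Qed.

Lemma spectral_row (R : realType) (d : nat) (A Q : 'M[R]_d) (a : 'rV[R]_d)
    (i : 'I_d) :
  spectral_decomposition A Q a -> row i Q *m A = a 0 i *: row i Q.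
Proof.
case=> hQ ->; rewrite -row_mul !mulmxA hQ mul1mx row_mul row_diag_mx.
by rewrite -scalemxAl -rowE.
Qed.

Lemma spectral_rows_dot (R : realType) (d : nat) (A Q : 'M[R]_d)
    (a : 'rV[R]_d) (i j : 'I_d) :
  spectral_decomposition A Q a -> vdot (row i Q) (row j Q) = (i == j)%:R.
Proof. by case=> hQ _; rewrite vdot_row hQ mxE. Qed.

Lemma spectral_eigenvalue (R : realType) (d : nat) (A Q : 'M[R]_d)
    (a : 'rV[R]_d) (i : 'I_d) :
  spectral_decomposition A Q a -> eigenvalue A (a 0 i).
Proof.
move=> sd; apply/eigenvalueP; exists (row i Q); first exact: spectral_row.
by rewrite -vdot_eq0 (spectral_rows_dot _ _ sd) eqxx oner_eq0.
Qed.

Lemma spectral_listing (R : realType) (d : nat) (A Q : 'M[R]_d)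
    (a : 'rV[R]_d) :
  spectral_decomposition A Q a -> eigenvalue_listing A (a 0).
Proof.
case=> hQ ->; rewrite /eigenvalue_listing /char_poly.
set M := char_poly_mx _.
have -> : M = map_mx polyC Q^T *m char_poly_mx (diag_mx a) *m map_mx polyC Q.
  rewrite /M /char_poly_mx mulmxBr mulmxBl !map_mxM; congr (_ - _).
  rewrite mul_mx_scalar -scalemxAl -map_mxM orthogonal_trmxl //.
  by rewrite map_mx1 scalemx1.
rewrite !det_mulmx mulrAC -det_mulmx -map_mxM orthogonal_trmxl // map_mx1.
rewrite det1 mul1r.
have := char_poly_trig (diag_mx_is_trig a); rewrite /char_poly => ->.
by apply: eq_bigr => i _; rewrite mxE eqxx.
Qed.

(** By unique factorization in R[X]. *)
Lemma listing_perm (R : realType) (d : nat) (A : 'M[R]_d) (a b : 'I_d -> R) :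
  eigenvalue_listing A a -> eigenvalue_listing A b ->
  exists s : {perm 'I_d}, forall i, a i = b (s i).
Proof.
rewrite /eigenvalue_listing => -> e.
have : perm_eq [tuple a i | i < d] [tuple b i | i < d].
  by apply: prod_XsubC_eq; rewrite !big_map -!big_enum /= in e *.
case/tuple_permP => s es; exists s => i.
have := congr1 (fun t => nth 0 t i) es.
by rewrite -!tnth_nth !tnth_mktuple.
Qed.

(** The condition on a negative eigenvalue says exactly that any two
    eigenvalues at different places of the list have a nonnegative sum, which is
    the form in which rotations see it. *)
Lemma at_most_one_small_neg_spectral (R : realType) (d : nat)
    (A Q : 'M[R]_d) (a : 'rV[R]_d) :
  spectral_decomposition A Q a ->
  at_most_one_small_neg A <->
    (forall k j : 'I_d, j != k -> 0 <= a 0 k + a 0 j).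
Proof.
move=> sd; have la := spectral_listing sd; split.
  case=> b [lb hb]; have [s es] := listing_perm la lb.
  suff h k j : j != k -> a 0 k < 0 -> 0 <= a 0 k + a 0 j.
    move=> k j jk; have [|k0] := ltP (a 0 k) 0; first exact: h.
    have [j0|j0] := ltP (a 0 j) 0; last by rewrite addr_ge0.
    by rewrite addrC h // eq_sym.
  rewrite !es => jk k0; have := hb _ k0 (s j); rewrite (inj_eq perm_inj).
  by case=> // _; rewrite ltr0_norm // => ?; lra.
move=> h; exists (a 0); split=> // k k0 j jk; rewrite ltr0_norm //.
by have := h _ _ jk; split; lra.
Qed.

(** * Bounding tr (U A) from above *)

Lemma orthogonal_diag_le1 (R : realType) (d : nat) (U : 'M[R]_d) (i : 'I_d) :
  orthogonal_mx U -> U i i <= 1.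
Proof.
move=> hU.
have: U i i ^+ 2 <= 1.
  have <- : vdot (row i U) (row i U) = 1 by rewrite vdot_row hU mxE eqxx.
  rewrite vdot_sumsq (bigD1 i) //= mxE lerDl.
  by apply: sumr_ge0 => j _; rewrite sqr_ge0.
by move=> ?; nra.
Qed.

Lemma orthogonal_mxtrace_le (R : realType) (d : nat) (U : 'M[R]_d) :
  orthogonal_mx U -> \tr U <= d%:R.
Proof.
move=> hU; rewrite -[d in d%:R]card_ord -sumr_const.
by apply: ler_sum => i _; exact: orthogonal_diag_le1.
Qed.

(** An orthogonal V of determinant -1 has a vector v with v V = - v, because
    V^T (1 + V) = (1 + V)^T makes det (1 + V) equal to its opposite.  Reflecting
    along v turns that eigenvalue -1 into 1, hence raises the trace by 2, and
    the result is still orthogonal. *)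
Lemma improper_mxtrace_le (R : realType) (d : nat) (V : 'M[R]_d) :
  orthogonal_mx V -> \det V = -1 -> \tr V <= d%:R - 2.
Proof.
move=> hV dV.
have /eqP/det0P[v v0 vV] : \det (1%:M + V) = 0.
  have e : V^T *m (1%:M + V) = (1%:M + V)^T.
    by rewrite mulmxDr mulmx1 orthogonal_trmxl // linearD /= trmx1 addrC.
  move/(congr1 determinant): e; rewrite det_mulmx !det_tr dV => ?; lra.
have {}vV : v *m V = - v.
  by apply/eqP; rewrite -addr_eq0 addrC -{1}[v]mulmx1 -mulmxDr vV.
have := orthogonal_mxtrace_le (orthogonal_mulmx (householder_orthogonal v) hV).
rewrite mxtrace_mul_householder vV -scaleN1r vdotZl mulN1r mulrN divfK.
  by move=> ?; lra.
by rewrite vdot_eq0.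
Qed.

(** Moving Q around the trace, tr (U A) is the sum of the a 0 i weighted by the
    diagonal entries of the orthogonal matrix Q U Q^T, none of which exceeds 1. *)
Lemma nonneg_spectrum_mxtrace_le (R : realType) (d : nat) (A Q U : 'M[R]_d)
    (a : 'rV[R]_d) :
  spectral_decomposition A Q a -> (forall i, 0 <= a 0 i) ->
  orthogonal_mx U -> \tr (U *m A) <= \tr A.
Proof.
move=> [hQ ->] a0 hU.
have hW : orthogonal_mx (Q *m U *m Q^T).
  by do 2?[apply: orthogonal_mulmx => //]; exact: orthogonal_trmx.
rewrite !mulmxA mxtrace_mulC [X in _ <= X]mxtrace_mulC !mulmxA hQ mul1mx.
rewrite mul_mx_diag mxtrace_diag; apply: ler_sum => i _.
by rewrite mxE ler_piMl //; exact: orthogonal_diag_le1.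
Qed.

Lemma householder_spectral (R : realType) (d : nat) (Q : 'M[R]_d)
    (k : 'I_d) :
  orthogonal_mx Q ->
  spectral_decomposition (householder (row k Q)) Q
    (\row_i (1 - 2 *+ (i == k))).
Proof.
move=> hQ; split=> //; rewrite /householder vdot_row hQ mxE eqxx divr1.
have -> : diag_mx (\row_i (1 - 2 *+ (i == k))) =
          1%:M - 2 *: delta_mx k k :> 'M[R]_d.
  apply/matrixP => i j; rewrite !mxE.
  have [->|ij] := eqVneq i j; first by rewrite andbb mulr1n mulr_natr.
  rewrite mulr0n; case: eqP => [ei|_]; last by rewrite mulr0 subr0.
  by rewrite -ei eq_sym (negPf ij) mulr0 subr0.
rewrite mulmxBr mulmxBl mulmx1 orthogonal_trmxl //; congr (_ - _).
rewrite -scalemxAr -scalemxAl; congr (_ *: _).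
rewrite rowE trmx_mul -mulmxA (mulmxA _ _ Q) trmx_delta mul_delta_mx.
by rewrite mulmxA.
Qed.

(** If a 0 k is the negative eigenvalue and H the reflection along its
    eigenvector, then A = - a 0 k H + B where B has the nonnegative eigenvalues
    a 0 i + a 0 k for i != k, and 0 at k.  For a rotation U the matrix U H has
    determinant -1, so tr (U H) <= d - 2 = tr H, while tr (U B) <= tr B. *)
Lemma pairwise_nonneg_mxtrace_le (R : realType) (d : nat) (A Q U : 'M[R]_d)
    (a : 'rV[R]_d) :
  spectral_decomposition A Q a ->
  (forall k j : 'I_d, j != k -> 0 <= a 0 k + a 0 j) ->
  rotation_mx U -> \tr (U *m A) <= \tr A.
Proof.
move=> sd ha [hU dU]; have [hQ eA] := sd.
have [a0|] := boolP [forall i, 0 <= a 0 i].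
  by apply: (nonneg_spectrum_mxtrace_le sd) hU => i; exact: (forallP a0).
rewrite negb_forall => /existsP[k]; rewrite -ltNge => k0.
pose H := householder (row k Q); have [_ eH] := householder_spectral k hQ.
have q0 : row k Q != 0.
  by rewrite -vdot_eq0 (spectral_rows_dot _ _ sd) eqxx oner_eq0.
have trH : \tr (U *m H) <= \tr H.
  have -> : \tr H = d%:R - 2.
    rewrite -[H]mulmx1 mxtrace_mul_householder mxtrace_scalar mulmx1.
    by rewrite divfK // vdot_eq0.
  apply: improper_mxtrace_le.
    exact: orthogonal_mulmx hU (householder_orthogonal _).
  by rewrite det_mulmx dU mul1r det_householder.
pose b := \row_i (a 0 i + a 0 k * (1 - 2 *+ (i == k))).
have sdB : spectral_decomposition (A + a 0 k *: H) Q b.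
  split=> //; rewrite {1}eA /H eH scalemxAl scalemxAr -mulmxDl -mulmxDr.
  congr (_ *m _ *m _); apply/matrixP => i j; rewrite !mxE.
  by case: (i == j); rewrite ?mulr1n // !mulr0n mulr0 addr0.
have /(nonneg_spectrum_mxtrace_le sdB)/(_ hU) : forall i, 0 <= b 0 i.
  move=> i; rewrite mxE; have [->|ik] := eqVneq i k.
    by rewrite mulr1n; lra.
  by rewrite subr0 mulr1 addrC ha.
rewrite mulmxDr -scalemxAr !mxtraceD !mxtraceZ => ?.
have := ler_wnM2l (ltW k0) trH; lra.
Qed.

(** * Consequences of the maximality of the trace *)

(** Test the maximality of the trace on the product of the reflections along u
    and v, which is a rotation. *)
Lemma max_rotation_quadratic (R : realType) (d : nat) (A : 'M[R]_d)
    (u v : 'rV[R]_d) :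
  max_trace_over (@rotation_mx R d) A ->
  2 * (vdot u v * vdot (v *m A) u) <=
    vdot v v * vdot (u *m A) u + vdot u u * vdot (v *m A) v.
Proof.
have [->|u0] := eqVneq u 0.
  by rewrite /vdot trmx0 !(mul0mx, mulmx0) mxE !(mulr0, mul0r, addr0).
have [->|v0] := eqVneq v 0.
  by rewrite /vdot trmx0 !(mul0mx, mulmx0) mxE !(mulr0, mul0r, addr0).
move=> /(_ (householder u *m householder v)).
have rot : rotation_mx (householder u *m householder v).
  split; first by apply: orthogonal_mulmx; exact: householder_orthogonal.
  by rewrite det_mulmx !det_householder // mulrNN mulr1.
move=> /(_ rot).
rewrite -mulmxA !mxtrace_mul_householder mulmxA mul_householder.
rewrite mulmxBl -scalemxAl -scaleNr vdotDl vdotZl mulNr.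
move: u0 v0; rewrite -!vdot_gt0.
set uu := vdot u u; set vv := vdot v v => u0 v0.
set uAu := vdot (u *m A) u; set vAv := vdot _ v; set vAu := vdot _ u.
set uv := vdot u v => h.
have : 0 <= 2 / (uu * vv) * (vv * uAu + uu * vAv - 2 * (uv * vAu)).
  have -> : 2 / (uu * vv) * (vv * uAu + uu * vAv - 2 * (uv * vAu)) =
    2 / vv * vAv + 2 / uu * (uAu - 2 * uv / vv * vAu).
    by field; rewrite !gt_eqF.
  by move: h; lra.
by rewrite pmulr_rge0 ?subr_ge0 // divr_gt0 ?mulr_gt0.
Qed.

Lemma linear_le_quadratic_eq0 (R : realType) (a b : R) :
  (forall t, t * a <= t ^+ 2 * b) -> a = 0.
Proof.
move=> h; apply/eqP/negPn/negP => a0.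
have b1 : 0 < 1 + `|b| by rewrite ltr_wpDr.
(* At this t the hypothesis divides by t ^+ 2 to 1 + `|b| <= b. *)
have := h (a / (1 + `|b|)).
have -> : a / (1 + `|b|) * a = (a / (1 + `|b|)) ^+ 2 * (1 + `|b|).
  by field; rewrite gt_eqF.
rewrite ler_pM2l; first by have := ler_norm b; lra.
by rewrite exprn_even_gt0 //= mulf_neq0 // invr_eq0 gt_eqF.
Qed.

(** For u = e_i + t e_j and v = e_i the quadratic inequality becomes
    t (A i j - A j i) <= t^2 (A i i + A j j) for every t, which forces the linear
    coefficient to vanish. *)
Lemma max_rotation_sym (R : realType) (d : nat) (A : 'M[R]_d) :
  max_trace_over (@rotation_mx R d) A -> A^T = A.
Proof.
move=> hA; apply/matrixP => j i; rewrite mxE; apply/eqP; rewrite -subr_eq0.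
have [->|ij] := eqVneq i j; first by rewrite subrr.
apply/eqP/(@linear_le_quadratic_eq0 _ _ (A i i + A j j)) => t.
pose e k : 'rV[R]_d := delta_mx 0 k.
have vA k l : vdot (e k *m A) (e l) = A k l by rewrite vdot_delta -rowE mxE.
have ee k l : vdot (e k) (e l) = (k == l)%:R.
  by rewrite vdot_delta mxE eqxx eq_sym.
have := @max_rotation_quadratic _ _ _ (e i + t *: e j) (e i) hA.
rewrite mulmxDl -scalemxAl !(vdotDl, vdotDr, vdotZl, vdotZr) !vA !ee.
rewrite !eqxx (negPf ij) eq_sym (negPf ij) /= mulr1n mulr0n.
by lra.
Qed.

Lemma max_rotation_pair (R : realType) (d : nat) (A : 'M[R]_d)
    (u v : 'rV[R]_d) :
  max_trace_over (@rotation_mx R d) A ->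
  vdot u u = 1 -> vdot v v = 1 -> vdot u v = 0 ->
  0 <= vdot (u *m A) u + vdot (v *m A) v.
Proof.
move=> hA uu vv uv; have := max_rotation_quadratic u v hA.
by rewrite uu vv uv mul0r mulr0 !mul1r.
Qed.

Lemma max_orthogonal_rotation (R : realType) (d : nat) (A : 'M[R]_d) :
  max_trace_over (@orthogonal_mx R d) A -> max_trace_over (@rotation_mx R d) A.
Proof. by move=> hA U [hU _]; exact: hA. Qed.

Lemma max_rotation_spectral (R : realType) (d : nat) (A Q : 'M[R]_d)
    (a : 'rV[R]_d) :
  spectral_decomposition A Q a ->
  max_trace_over (@rotation_mx R d) A <->
    (forall k j : 'I_d, j != k -> 0 <= a 0 k + a 0 j).
Proof.
move=> sd; split=> [hA k j jk|ha U]; last exact: (pairwise_nonneg_mxtrace_le sd).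
have qq i i' := spectral_rows_dot i i' sd.
have : 0 <= vdot (row k Q *m A) (row k Q) + vdot (row j Q *m A) (row j Q).
  by apply: max_rotation_pair hA _ _ _; rewrite qq ?eqxx // eq_sym (negPf jk).
by rewrite !(spectral_row _ sd) !vdotZl !qq !eqxx !mulr1.
Qed.

(** Reflecting along an eigenvector of eigenvalue l changes the trace by -2 l. *)
Lemma max_orthogonal_eigenvalue_ge0 (R : realType) (d : nat) (A : 'M[R]_d)
    (l : R) :
  max_trace_over (@orthogonal_mx R d) A -> eigenvalue A l -> 0 <= l.
Proof.
move=> hA /eigenvalueP[v vA v0].
have := hA _ (householder_orthogonal v).
rewrite mxtrace_mul_householder vA vdotZl mulrCA divfK ?vdot_eq0 //.
by move=> ?; lra.
Qed.

(** Pair each index with its cyclic successor, which differs from it once there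
    are at least two indices; the pair sums add up to twice the trace. *)
Lemma mxtrace_ge0_pairs (R : realType) (d : nat) (A : 'M[R]_d) :
  d <> 1%N -> (forall i j : 'I_d, j != i -> 0 <= A i i + A j j) -> 0 <= \tr A.
Proof.
case: d A => [|[|d]] A // _ hA; first by rewrite /mxtrace big_ord0.
have : 0 <= \sum_i (A i i + A (i + 1) (i + 1)).
  by apply: sumr_ge0 => i _; rewrite hA // -subr_eq0 addrC addKr oner_eq0.
rewrite big_split /=; have <- : \tr A = \sum_i A (i + 1) (i + 1).
  by rewrite /mxtrace (reindex_inj (addIr 1)).
by rewrite -/(\tr A) => ?; lra.
Qed.

Theorem corollary1 (R : realType) (d : nat) (A : 'M[R]_d) :
  [/\ max_trace_over (@orthogonal_mx R d) A <->
        A \is symmetricmx /\ possemidef A,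
      max_trace_over (@rotation_mx R d) A <->
        A \is symmetricmx /\ at_most_one_small_neg A,
      max_trace_over (@orthogonal_mx R d) A -> 0 <= \tr A
    & d <> 1%N -> max_trace_over (@rotation_mx R d) A -> 0 <= \tr A].
Proof.
split.
- split=> [hA|[/symmetricmxP sA [_ hA]] U hU].
    have sA : A \is symmetricmx.
      exact/symmetricmxP/max_rotation_sym/max_orthogonal_rotation.
    by split=> //; split=> // a; exact: max_orthogonal_eigenvalue_ge0.
  have [Q [a sd]] := symmetric_spectral sA.
  by apply: (nonneg_spectrum_mxtrace_le sd) hU => i; exact/hA/(spectral_eigenvalue _ sd).
- split=> [hA|[/symmetricmxP sA hA]].
    have sA := max_rotation_sym hA; split; first exact/symmetricmxP.
    have [Q [a sd]] := symmetric_spectral sA.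
    exact/(at_most_one_small_neg_spectral sd)/(max_rotation_spectral sd).
  have [Q [a sd]] := symmetric_spectral sA.
  exact/(max_rotation_spectral sd)/(at_most_one_small_neg_spectral sd).
- (* The orthogonal matrix -1 suffices: it gives - \tr A <= \tr A. *)
  move=> /(_ (- 1%:M)); rewrite mulNmx mul1mx linearN /=.
  have o : orthogonal_mx (- 1%:M : 'M[R]_d).
    by rewrite /orthogonal_mx linearN /= trmx1 mulNmx mulmxN opprK mulmx1.
  by move=> /(_ o) ?; lra.
- move=> d1 hA; apply: mxtrace_ge0_pairs => // i j ij.
  pose e k : 'rV[R]_d := delta_mx 0 k.
  have ee k l : vdot (e k) (e l) = (k == l)%:R.
    by rewrite vdot_delta mxE eqxx eq_sym.
  have : 0 <= vdot (e i *m A) (e i) + vdot (e j *m A) (e j).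
    by apply: max_rotation_pair hA _ _ _; rewrite ee ?eqxx // eq_sym (negPf ij).
  by rewrite !vdot_delta -!rowE !mxE.
Qed.
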